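(* Let $\mathbb{K}$ be a field. Any unital object $Y$ in the category $\mathsf{BiAlg}_{\mathbb{K}}$ of all $\mathbb{K}$-bialgebras is cocommutative.
   Context: $\mathsf{BiAlg}_{\mathbb{K}}$ is the category of all (not necessarily cocommutative) $\mathbb{K}$-bialgebras (associative, unital, coassociative, counital), with bialgebra morphisms (algebra and coalgebra maps preserving units and counits). It is a pointed category with finite limits, with zero object $\mathbb{K}$; $X\times Y$ denotes the categorical product in $\mathsf{BiAlg}_{\mathbb{K}}$ and $0$ denotes a zero morphism. A pair of arrows $(k\colon K\to X,\ s\colon Y\to X)$ is jointly extremally epimorphic when, for every monomorphism (in the categorical sense) $m\colon M\to X$ such that both $k$ and $s$ factor through $m$, the morphism $m$ is an isomorphism. An object $Y$ of a pointed category with finite limits is a unital object when, for every object $X$, the split extension with kernel $\langle 1_X,0\rangle\colon X\to X\times Y$, split epimorphism $\pi_Y\colon X\times Y\to Y$ and section $\langle 0,1_Y\rangle\colon Y\to X\times Y$ is strong, i.e. the pair $(\langle 1_X,0\rangle,\langle 0,1_Y\rangle)$ is jointly extremally epimorphic. *)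

(* Defs.v *)
From HB Require Import structures.
From mathcomp Require Import all_boot all_algebra sesquilinear boolp.

Set Implicit Arguments.
Unset Strict Implicit.
Unset Printing Implicit Defensive.

Import GRing.Theory.
Local Open Scope ring_scope.
Local Open Scope quotient_scope.

Declare Scope tensor_scope.
Local Open Scope tensor_scope.

Reserved Notation "V \ox W" (at level 40, left associativity).
Reserved Notation "v *t w" (at level 40, left associativity).

Notation is_bilinear f := (bilinear_for *:%R *:%R f).

(* The elements of the tensor product are formal sums of pairs, represented by
   sequences; two formal sums are identified when no bilinear map separates
   them. The lemmas tmul_bilinear, tlift_tmul, tlift_linear, tensor_ind and
   tensor_ext below establish the universal property. *)
Section TensorType.
Variables (K : fieldType) (V W : lmodType K).

Definition fsum (U : lmodType K) (f : V -> W -> U) (s : seq (V * W)) : U :=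
  \sum_(p <- s) f p.1 p.2.

Definition tens_rel (s t : seq (V * W)) : bool :=
  `[< forall (U : lmodType K) (f : V -> W -> U),
        is_bilinear f -> fsum f s = fsum f t >].

Lemma tens_relP s t :
  reflect (forall (U : lmodType K) (f : V -> W -> U),
             is_bilinear f -> fsum f s = fsum f t) (tens_rel s t).
Proof. exact: asboolP. Qed.

Lemma tens_rel_refl : reflexive tens_rel.
Proof. by move=> s; apply/tens_relP. Qed.

Lemma tens_rel_sym : symmetric tens_rel.
Proof.
by move=> s t; apply/tens_relP/tens_relP => h U f bf; rewrite h.
Qed.

Lemma tens_rel_trans : transitive tens_rel.
Proof.
move=> t s u /tens_relP h1 /tens_relP h2; apply/tens_relP => U f bf.
by rewrite h1 // h2.
Qed.

Canonical tens_equiv := EquivRel tens_rel tens_rel_refl tens_rel_sym tens_rel_trans.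

Definition tensor : Type := {eq_quot tens_equiv}.
HB.instance Definition _ := Choice.on tensor.

Definition tclass (s : seq (V * W)) : tensor := \pi_{eq_quot tens_equiv} s.
Definition trepr (x : tensor) : seq (V * W) := repr (x : {eq_quot tens_equiv}).

Definition tmul (v : V) (w : W) : tensor := tclass [:: (v, w)].

(* Only meaningful when f is bilinear. *)
Definition tlift (U : lmodType K) (f : V -> W -> U) (x : tensor) : U :=
  fsum f (trepr x).

Lemma tclassE s t :
  (forall (U : lmodType K) (f : V -> W -> U),
     is_bilinear f -> fsum f s = fsum f t) -> tclass s = tclass t.
Proof. by move=> h; apply/eqmodP/tens_relP. Qed.

Lemma treprK x : tclass (trepr x) = x.
Proof. exact: reprK. Qed.

Lemma tlift_class (U : lmodType K) (f : V -> W -> U) s :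
  is_bilinear f -> tlift f (tclass s) = fsum f s.
Proof.
move=> bf; have /eqmodP/tens_relP h : tclass (trepr (tclass s)) = tclass s.
  exact: treprK.
exact: h.
Qed.

Lemma tlift_inj x y :
  (forall (U : lmodType K) (f : V -> W -> U),
     is_bilinear f -> tlift f x = tlift f y) -> x = y.
Proof. by move=> h; rewrite -(treprK x) -(treprK y); apply: tclassE. Qed.

Definition tzero : tensor := tclass [::].
Definition tadd x y : tensor := tclass (trepr x ++ trepr y).
Definition tscale (a : K) x : tensor :=
  tclass [seq (a *: p.1, p.2) | p <- trepr x].
Definition topp x : tensor := tscale (-1) x.

Section Lift.
Variables (U : lmodType K) (f : V -> W -> U).
Hypothesis bf : is_bilinear f.

Lemma bilinZ a v w : f (a *: v) w = a *: f v w.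
Proof. exact: (scalable_linear (bf.1 w)). Qed.

Lemma tlift0 : tlift f tzero = 0.
Proof. by rewrite tlift_class // /fsum big_nil. Qed.

Lemma tliftD x y : tlift f (tadd x y) = tlift f x + tlift f y.
Proof. by rewrite tlift_class // /fsum big_cat. Qed.

Lemma tliftZ a x : tlift f (tscale a x) = a *: tlift f x.
Proof.
rewrite tlift_class // /fsum big_map scaler_sumr.
by apply: eq_bigr => p _; rewrite bilinZ.
Qed.

End Lift.

Lemma taddA : associative tadd.
Proof. by move=> x y z; apply: tlift_inj => U f bf; rewrite !tliftD // addrA. Qed.

Lemma taddC : commutative tadd.
Proof. by move=> x y; apply: tlift_inj => U f bf; rewrite !tliftD // addrC. Qed.

Lemma tadd0 : left_id tzero tadd.
Proof.
by move=> x; apply: tlift_inj => U f bf; rewrite tliftD // tlift0 // add0r.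
Qed.

Lemma taddN : left_inverse tzero topp tadd.
Proof.
move=> x; apply: tlift_inj => U f bf.
by rewrite tliftD // tliftZ // tlift0 // scaleN1r addNr.
Qed.

HB.instance Definition _ := GRing.isZmodule.Build tensor taddA taddC tadd0 taddN.

Lemma tscaleA a b x : tscale a (tscale b x) = tscale (a * b) x.
Proof. by apply: tlift_inj => U f bf; rewrite !tliftZ // scalerA. Qed.

Lemma tscale1 : left_id 1 tscale.
Proof. by move=> x; apply: tlift_inj => U f bf; rewrite tliftZ // scale1r. Qed.

Lemma tscaleDr : right_distributive tscale +%R.
Proof.
move=> a x y; apply: tlift_inj => U f bf.
by rewrite !(tliftD, tliftZ) // scalerDr.
Qed.

Lemma tscaleDl x : {morph tscale^~ x : a b / a + b}.
Proof.
move=> a b; apply: tlift_inj => U f bf.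
by rewrite !(tliftD, tliftZ) // scalerDl.
Qed.

HB.instance Definition _ :=
  GRing.Zmodule_isLmodule.Build K tensor tscaleA tscale1 tscaleDr tscaleDl.

Lemma tmul_bilinear : is_bilinear tmul.
Proof.
split=> [w a v v'|v a w w']; apply: tlift_inj => U f bf;
  rewrite (tliftD bf) (tliftZ bf) !tlift_class // /fsum !big_seq1 /=.
- exact: bf.1.
- exact: bf.2.
Qed.

Lemma tlift_tmul (U : lmodType K) (f : V -> W -> U) v w :
  is_bilinear f -> tlift f (tmul v w) = f v w.
Proof. by move=> bf; rewrite tlift_class // /fsum big_seq1. Qed.

Lemma tlift_linear (U : lmodType K) (f : V -> W -> U) :
  is_bilinear f -> linear (tlift f).
Proof. by move=> bf a x y; rewrite (tliftD bf) (tliftZ bf). Qed.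

Lemma tensor_sum x : x = \sum_(p <- trepr x) tmul p.1 p.2.
Proof.
rewrite -{1}(treprK x); elim: (trepr x) => [|[v w] s ih]; first by rewrite big_nil.
rewrite big_cons -ih /=; apply: tlift_inj => U f bf.
by rewrite (tliftD bf) !tlift_class // /fsum big_cons big_seq1.
Qed.

Lemma tensor_ind (P : tensor -> Prop) :
  P 0 -> (forall v w x, P x -> P (tmul v w + x)) -> forall x, P x.
Proof.
move=> P0 PD x; rewrite [x]tensor_sum.
by elim: (trepr x) => [|p s ih]; rewrite ?big_nil // big_cons; apply: PD.
Qed.

Lemma tensor_ext (U : lmodType K) (f g : tensor -> U) :
  linear f -> linear g -> (forall v w, f (tmul v w) = g (tmul v w)) -> f =1 g.
Proof.
move=> lf lg fg; elim/tensor_ind => [|v w x ih].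
  by rewrite -[0](subrr 0) (zmod_morphism_linear lf) (zmod_morphism_linear lg) !subrr.
by rewrite -[tmul v w]scale1r lf lg fg ih.
Qed.

End TensorType.

Arguments tensor_ind [K V W] P.

Notation "V \ox W" := (tensor V W) : type_scope.
Notation "v *t w" := (tmul v w) : tensor_scope.

Section TensorMaps.
Variable K : fieldType.
Implicit Types U V W : lmodType K.

(* The maps f and g are expected to be linear. *)
Definition tmap V V' W W' (f : V -> V') (g : W -> W') (x : V \ox W) : V' \ox W' :=
  tlift (fun v w => f v *t g w) x.

Definition tswap V W (x : V \ox W) : W \ox V := tlift (fun v w => w *t v) x.

Definition tassoc U V W (x : (U \ox V) \ox W) : U \ox (V \ox W) :=
  tlift (fun (y : U \ox V) w => tlift (fun u v => u *t (v *t w)) y) x.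

Lemma tmulDl V W (v v' : V) (w : W) : (v + v') *t w = v *t w + v' *t w.
Proof. by have /= := (tmul_bilinear V W).1 w 1 v v'; rewrite !scale1r. Qed.

Lemma tmulDr V W (v : V) (w w' : W) : v *t (w + w') = v *t w + v *t w'.
Proof. by have /= := (tmul_bilinear V W).2 v 1 w w'; rewrite !scale1r. Qed.

Lemma tmulZl V W a (v : V) (w : W) : (a *: v) *t w = a *: (v *t w).
Proof. exact: (scalable_linear ((tmul_bilinear V W).1 w)). Qed.

Lemma tmulZr V W a (v : V) (w : W) : v *t (a *: w) = a *: (v *t w).
Proof. exact: (scalable_linear ((tmul_bilinear V W).2 v)). Qed.

Lemma tmap_bilinear V V' W W' (f : V -> V') (g : W -> W') :
  linear f -> linear g -> is_bilinear (fun v w => f v *t g w).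
Proof.
move=> lf lg; split=> [w a v v'|v a w w'] /=.
- by rewrite lf tmulDl tmulZl.
- by rewrite lg tmulDr tmulZr.
Qed.

Lemma tmap_linear V V' W W' (f : V -> V') (g : W -> W') :
  linear f -> linear g -> linear (tmap f g).
Proof. by move=> lf lg; apply/tlift_linear/tmap_bilinear. Qed.

Lemma tmapE V V' W W' (f : V -> V') (g : W -> W') v w :
  linear f -> linear g -> tmap f g (v *t w) = f v *t g w.
Proof. by move=> lf lg; rewrite /tmap tlift_tmul //; apply: tmap_bilinear. Qed.

Lemma tswapE V W (v : V) (w : W) : tswap (v *t w) = w *t v.
Proof.
rewrite /tswap tlift_tmul //; split=> [y a x x'|x a y y'] /=.
- by rewrite tmulDr tmulZr.
- by rewrite tmulDl tmulZl.
Qed.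

Lemma tassoc_subproof1 U V W (w : W) :
  is_bilinear (fun (u : U) (v : V) => u *t (v *t w)).
Proof.
by split=> [y a x x'|x a y y'] /=; rewrite !(tmulDl, tmulZl, tmulDr, tmulZr).
Qed.

Arguments tassoc_subproof1 {U V W} w.

Lemma tassoc_bilinear U V W :
  is_bilinear (fun (y : U \ox V) (w : W) => tlift (fun u v => u *t (v *t w)) y).
Proof.
split=> [w a y y'|y a w w'] /=.
  by rewrite (tlift_linear (tassoc_subproof1 w)).
elim/tensor_ind: y => [|u v x ih].
  by rewrite !(tlift0 (tassoc_subproof1 _)) scaler0 addr0.
rewrite !(tliftD (tassoc_subproof1 _)) ih !tlift_tmul; try exact: tassoc_subproof1.
by rewrite !tmulDr !tmulZr scalerDr addrACA.
Qed.

Lemma tassocE U V W (u : U) (v : V) (w : W) :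
  tassoc (u *t v *t w) = u *t (v *t w).
Proof.
rewrite /tassoc (tlift_tmul _ _ (@tassoc_bilinear U V W)).
exact: tlift_tmul (tassoc_subproof1 w).
Qed.

Lemma tassoc_linear U V W : linear (@tassoc U V W).
Proof. exact/tlift_linear/tassoc_bilinear. Qed.

End TensorMaps.

(* The algebra A \ox B, with (a *t b) * (a' *t b') = (a * a') *t (b * b'). It is
   declared as a possibly trivial ring because its nontriviality is not
   provable without producing linear forms on A and B. *)
Section TensorAlgebra.
Variables (K : fieldType) (A B : algType K).

Definition tprod (x y : A \ox B) : A \ox B :=
  tlift (fun a b => tlift (fun a' b' => (a * a') *t (b * b')) y) x.

Lemma tprod_subproof1 (a : A) (b : B) :
  is_bilinear (fun (a' : A) (b' : B) => (a * a') *t (b * b')).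
Proof.
by split=> [y c x x'|x c y y'] /=;
  rewrite mulrDr -scalerAr !(tmulDl, tmulZl, tmulDr, tmulZr).
Qed.

Lemma tprod_subproof2 (y : A \ox B) : is_bilinear (fun (a : A) (b : B) =>
  tlift (fun a' b' => (a * a') *t (b * b')) y).
Proof.
have E0 a b := tlift0 (tprod_subproof1 a b).
have ED a b := tliftD (tprod_subproof1 a b).
have E a b a' b' := tlift_tmul a' b' (tprod_subproof1 a b).
split=> [b c a a'|a c b b'] /=; elim/tensor_ind: y => [|u v x ih].
- by rewrite !E0 scaler0 addr0.
- rewrite !ED ih !E mulrDl -scalerAl tmulDl tmulZl scalerDr.
  by rewrite addrACA.
- by rewrite !E0 scaler0 addr0.
- rewrite !ED ih !E mulrDl -scalerAl tmulDr tmulZr scalerDr.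
  by rewrite addrACA.
Qed.

Lemma tprodE a b a' b' : tprod (a *t b) (a' *t b') = (a * a') *t (b * b').
Proof.
rewrite /tprod (tlift_tmul _ _ (tprod_subproof2 _)).
exact: tlift_tmul (tprod_subproof1 a b).
Qed.

Lemma tprod_linearl y : linear (tprod^~ y).
Proof. exact/tlift_linear/tprod_subproof2. Qed.

Lemma tprod_linearr x : linear (tprod x).
Proof.
move=> c y y'; rewrite /tprod.
elim/tensor_ind: x => [|u v x ih].
  by rewrite !(tlift0 (tprod_subproof2 _)) scaler0 addr0.
rewrite !(tliftD (tprod_subproof2 _)) ih !tlift_tmul; try exact: tprod_subproof2.
by rewrite (tlift_linear (tprod_subproof1 u v)) scalerDr addrACA.
Qed.

Lemma tprodDl : left_distributive tprod +%R.
Proof.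
by move=> x y z; have /= := tprod_linearl z 1 x y; rewrite !scale1r.
Qed.

Lemma tprodDr : right_distributive tprod +%R.
Proof.
by move=> z x y; have /= := tprod_linearr z 1 x y; rewrite !scale1r.
Qed.

Lemma tprod0l x : tprod 0 x = 0.
Proof. by apply: (addrI (tprod 0 x)); rewrite -tprodDl !addr0. Qed.

Lemma tprod0r x : tprod x 0 = 0.
Proof. by apply: (addrI (tprod x 0)); rewrite -tprodDr !addr0. Qed.

Lemma tprodA : associative tprod.
Proof.
elim/tensor_ind=> [|a b x ihx] y z; first by rewrite !tprod0l.
rewrite !tprodDl ihx; congr (_ + _); clear ihx.
elim/tensor_ind: y => [|a' b' y ihy]; first by rewrite !(tprod0l, tprod0r).
rewrite !(tprodDl, tprodDr) ihy; congr (_ + _); clear ihy.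
elim/tensor_ind: z => [|a2 b2 z ihz]; first by rewrite !(tprod0l, tprod0r).
by rewrite !(tprodDl, tprodDr) ihz !tprodE !mulrA.
Qed.

Lemma tprod1l : left_id (1 *t 1) tprod.
Proof.
elim/tensor_ind=> [|a b x ih]; first by rewrite tprod0r.
by rewrite tprodDr ih tprodE !mul1r.
Qed.

Lemma tprod1r : right_id (1 *t 1) tprod.
Proof.
elim/tensor_ind=> [|a b x ih]; first by rewrite tprod0l.
by rewrite tprodDl ih tprodE !mulr1.
Qed.

HB.instance Definition _ := GRing.Zmodule_isPzRing.Build (A \ox B)
  tprodA tprod1l tprod1r tprodDl tprodDr.

End TensorAlgebra.

(* A bialgebra is automatically a nontrivial ring, since counit 1 = 1 != 0 in K,
   so that it is harmless that algType only contains nontrivial rings. *)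
Record bialgebra (K : fieldType) := Bialgebra {
  bialg_alg :> algType K;
  comul : {linear bialg_alg -> bialg_alg \ox bialg_alg};
  counit : {scalar bialg_alg};
  comulA : forall x,
    tassoc (tmap comul idfun (comul x)) = tmap idfun comul (comul x);
  counitl : forall x, tlift (fun a b => counit a *: b) (comul x) = x;
  counitr : forall x, tlift (fun a b => counit b *: a) (comul x) = x;
  comul_monoid : monoid_morphism comul;
  counit_monoid : monoid_morphism counit
}.

Arguments comul {K b}.
Arguments counit {K b}.

Definition cocommutative (K : fieldType) (A : bialgebra K) : Prop :=
  forall x : A, tswap (comul x) = comul x.

Record bialg_hom (K : fieldType) (X Y : bialgebra K) := BialgHom {
  bialg_fun :> X -> Y;
  bialg_hom_linear : linear bialg_fun;
  bialg_hom_monoid : monoid_morphism bialg_fun;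
  bialg_hom_comul : forall x, comul (bialg_fun x) = tmap bialg_fun bialg_fun (comul x);
  bialg_hom_counit : forall x, counit (bialg_fun x) = counit x
}.

Lemma bialg_hom_eq (K : fieldType) (X Y : bialgebra K) (f g : bialg_hom X Y) :
  f =1 g -> f = g.
Proof.
case: f g => [f f1 f2 f3 f4] [g g1 g2 g3 g4] /= /funext fg.
by subst g; congr BialgHom; apply: Prop_irrelevance.
Qed.

Record category := Category {
  ob :> Type;
  hom : ob -> ob -> Type;
  idm : forall X, hom X X;
  comp : forall X Y Z, hom Y Z -> hom X Y -> hom X Z;
  compA : forall X Y Z T (h : hom Z T) (g : hom Y Z) (f : hom X Y),
    comp h (comp g f) = comp (comp h g) f;
  comp1m : forall X Y (f : hom X Y), comp (idm Y) f = f;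
  compm1 : forall X Y (f : hom X Y), comp f (idm X) = f
}.

Arguments hom {c} X Y.
Arguments idm {c} X.
Arguments comp {c X Y Z} g f.

Record pointed_category := PointedCategory {
  pcat :> category;
  zero_ob : pcat;
  to_zero : forall X : pcat, hom X zero_ob;
  to_zero_unique : forall (X : pcat) (f : hom X zero_ob), f = to_zero X;
  from_zero : forall X : pcat, hom zero_ob X;
  from_zero_unique : forall (X : pcat) (f : hom zero_ob X), f = from_zero X
}.

Definition zerom (C : pointed_category) (X Y : C) : hom X Y :=
  comp (from_zero Y) (to_zero X).

Section CategoricalNotions.
Variable C : category.
Implicit Types X Y Z K M : C.

Definition monomorphism M X (m : hom M X) : Prop :=
  forall Z (f g : hom Z M), comp m f = comp m g -> f = g.

Definition isomorphism X Y (f : hom X Y) : Prop :=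
  exists g : hom Y X, comp g f = idm X /\ comp f g = idm Y.

Definition factors_through Z M X (f : hom Z X) (m : hom M X) : Prop :=
  exists g : hom Z M, comp m g = f.

Definition jointly_extremally_epic K X Y (k : hom K X) (s : hom Y X) : Prop :=
  forall M (m : hom M X), monomorphism m ->
    factors_through k m -> factors_through s m -> isomorphism m.

Record product X Y := Product {
  prod_ob : C;
  proj1 : hom prod_ob X;
  proj2 : hom prod_ob Y;
  pairing : forall Z, hom Z X -> hom Z Y -> hom Z prod_ob;
  proj1_pairing : forall Z (f : hom Z X) (g : hom Z Y),
    comp proj1 (pairing f g) = f;
  proj2_pairing : forall Z (f : hom Z X) (g : hom Z Y),
    comp proj2 (pairing f g) = g;
  pairing_unique : forall Z (f : hom Z X) (g : hom Z Y) (h : hom Z prod_ob),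
    comp proj1 h = f -> comp proj2 h = g -> h = pairing f g
}.

End CategoricalNotions.

Arguments pairing {C X Y} p {Z}.

(* In a category with finite limits the product of X and Y exists and is unique
   up to isomorphism, so that asking for some product or for all of them is the
   same. *)
Definition unital_object (C : pointed_category) (Y : C) : Prop :=
  forall X : C, exists P : product X Y,
    jointly_extremally_epic (pairing P (idm X) (zerom X Y))
                            (pairing P (zerom Y X) (idm Y)).

Section BiAlg.
Variable K : fieldType.
Implicit Types X Y Z : bialgebra K.

Lemma bialg_id_comul X (x : X) : comul (idfun x) = tmap idfun idfun (comul x).
Proof.
have l : linear (@idfun X) by [].
suff -> : tmap idfun idfun =1 @idfun (X \ox X) by [].
apply: tensor_ext => [|//|v w]; first exact: tmap_linear.
by rewrite tmapE.
Qed.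

Definition bialg_id X : bialg_hom X X := @BialgHom K X X idfun
  (fun _ _ _ => erefl) (conj erefl (fun _ _ => erefl))
  (@bialg_id_comul X) (fun _ => erefl).

Section Comp.
Variables (X Y Z : bialgebra K) (g : bialg_hom Y Z) (f : bialg_hom X Y).

Lemma bialg_comp_linear : linear (g \o f).
Proof. by move=> a x y /=; rewrite !bialg_hom_linear. Qed.

Lemma bialg_comp_monoid : monoid_morphism (g \o f).
Proof.
by split=> [|x y] /=; rewrite ?(bialg_hom_monoid f).1 ?(bialg_hom_monoid g).1
  ?(bialg_hom_monoid f).2 ?(bialg_hom_monoid g).2.
Qed.

Lemma bialg_comp_comul x :
  comul ((g \o f) x) = tmap (g \o f) (g \o f) (comul x).
Proof.
rewrite /= !bialg_hom_comul.
have lf := @bialg_hom_linear _ _ _ f; have lg := @bialg_hom_linear _ _ _ g.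
have lgf := bialg_comp_linear.
have lff := tmap_linear lf lf; have lgg := tmap_linear lg lg.
suff E : tmap g g \o tmap f f =1 tmap (g \o f) (g \o f) by exact: E.
apply: tensor_ext.
- by move=> a u v; rewrite /= lff lgg.
- exact: tmap_linear.
- by move=> u v; rewrite /= !tmapE.
Qed.

Lemma bialg_comp_counit x : counit ((g \o f) x) = counit x.
Proof. by rewrite /= !bialg_hom_counit. Qed.

Definition bialg_comp : bialg_hom X Z := BialgHom
  bialg_comp_linear bialg_comp_monoid bialg_comp_comul bialg_comp_counit.

End Comp.

Definition BiAlgCat : category.
Proof.
by refine (@Category (bialgebra K) (@bialg_hom K) bialg_id bialg_comp _ _ _);
  move=> *; apply: bialg_hom_eq.
Defined.

Definition base_comul (a : K^o) : K^o \ox K^o := (a : K) *: @tmul K K^o K^o 1 1.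
Definition base_counit (a : K^o) : K := a.

Lemma base_comul_linear : linear base_comul.
Proof. by move=> a x y; rewrite /base_comul scalerDl scalerA. Qed.

Lemma base_counit_linear : scalar base_counit.
Proof. by []. Qed.

HB.instance Definition _ := GRing.isLinear.Build K K^o (K^o \ox K^o) _ base_comul
  base_comul_linear.
HB.instance Definition _ := GRing.isLinear.Build K K^o K _ base_counit
  base_counit_linear.

Lemma base_comulA (x : K^o) :
  tassoc (tmap base_comul idfun (base_comul x)) =
  tmap idfun base_comul (base_comul x).
Proof.
have l : linear (@idfun K^o) by [].
rewrite {2 4}/base_comul (scalable_linear (tmap_linear base_comul_linear l)).
rewrite (scalable_linear (tmap_linear l base_comul_linear)).
rewrite (scalable_linear (@tassoc_linear _ _ _ _)).
rewrite !tmapE //; try exact: base_comul_linear.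
by rewrite /base_comul !scale1r tassocE.
Qed.

Lemma base_counitl (x : K^o) :
  tlift (fun a b : K^o => base_counit a *: b) (base_comul x) = x.
Proof.
have bl : is_bilinear (fun a b : K^o => base_counit a *: b).
  by split=> [b c a a'|a c b b'] /=; rewrite ?scalerDl ?scalerDr !scalerA // mulrC.
rewrite (scalable_linear (tlift_linear bl)) tlift_tmul //.
by rewrite /base_counit !scale1r [LHS]mulr1.
Qed.

Lemma base_counitr (x : K^o) :
  tlift (fun a b : K^o => base_counit b *: a) (base_comul x) = x.
Proof.
have bl : is_bilinear (fun a b : K^o => base_counit b *: a).
  by split=> [b c a a'|a c b b'] /=; rewrite ?scalerDl ?scalerDr !scalerA // mulrC.
rewrite (scalable_linear (tlift_linear bl)) tlift_tmul //.
by rewrite /base_counit !scale1r [LHS]mulr1.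
Qed.

Lemma base_comul_monoid : monoid_morphism base_comul.
Proof.
split=> [|x y]; first exact: scale1r.
rewrite /base_comul.
set e := tmul _ _.
have ee : tprod e e = e by rewrite /e tprodE !mulr1.
have -> : (x : K) *: e * ((y : K) *: e) = (x : K) *: tprod e ((y : K) *: e).
  exact: (scalable_linear (tprod_linearl _)).
by rewrite (scalable_linear (tprod_linearr e)) ee scalerA.
Qed.

Lemma base_counit_monoid : monoid_morphism base_counit.
Proof. by []. Qed.

Definition bialg_base : bialgebra K := @Bialgebra K K^o base_comul base_counit
  base_comulA base_counitl base_counitr base_comul_monoid base_counit_monoid.

Section ZeroMaps.
Variable X : bialgebra K.

Definition unit_map (a : bialg_base) : X := (a : K) *: 1.

Lemma unit_linear : linear unit_map.
Proof. by move=> a x y; rewrite /unit_map scalerDl scalerA. Qed.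

Lemma unit_monoid : monoid_morphism unit_map.
Proof.
split=> [|a b]; first exact: scale1r.
by rewrite /unit_map -scalerAl mul1r scalerA.
Qed.

Lemma unit_comul (a : bialg_base) :
  comul (unit_map a) = tmap unit_map unit_map (comul a).
Proof.
rewrite /unit_map linearZ /= (comul_monoid X).1.
rewrite (scalable_linear (tmap_linear unit_linear unit_linear)).
by rewrite (tmapE _ _ unit_linear unit_linear) !unit_monoid.1.
Qed.

Lemma unit_counit (a : bialg_base) : counit (unit_map a) = counit a.
Proof.
rewrite /unit_map linearZ /= (counit_monoid X).1.
exact: mulr1.
Qed.

Definition bialg_unit : bialg_hom bialg_base X :=
  BialgHom unit_linear unit_monoid unit_comul unit_counit.

Lemma eps_linear : linear (counit : X -> bialg_base).
Proof. exact: (linearP (counit : {scalar X})). Qed.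

Lemma eps_comul (x : X) : comul (counit x : bialg_base) =
  tmap (counit : X -> bialg_base) (counit : X -> bialg_base) (comul x).
Proof.
have lh : linear (fun y : X => base_comul (counit y)).
  by move=> a u v; rewrite eps_linear base_comul_linear.
have bl : is_bilinear (fun a b : X => counit a *: b).
  split=> [b c a a'|a c b b'] /=.
    have -> : counit (c *: a + a') = c * counit a + counit a' by exact: linearP.
    by rewrite scalerDl scalerA.
  by rewrite scalerDr !scalerA mulrC.
rewrite -{1}(counitl x).
suff E : (fun y : X => base_comul (counit y))
   \o tlift (fun a b : X => counit a *: b) =1
   tmap (counit : X -> bialg_base) (counit : X -> bialg_base) by exact: E.
apply: tensor_ext.
- by move=> a u v; rewrite /= (tlift_linear bl) lh.
- exact: tmap_linear eps_linear eps_linear.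
- move=> u v; rewrite /= tlift_tmul // tmapE; try exact: eps_linear.
  rewrite (scalarZ (counit : {scalar X})) /base_comul -scalerA -tmulZr -tmulZl.
  by congr (_ *t _); apply: mulr1.
Qed.

Definition bialg_counit : bialg_hom X bialg_base := @BialgHom K X bialg_base
  counit eps_linear (counit_monoid X)
  eps_comul (fun _ => erefl).

Lemma bialg_counit_unique (f : bialg_hom X bialg_base) : f = bialg_counit.
Proof. by apply: bialg_hom_eq => x; apply: (bialg_hom_counit f x). Qed.

Lemma bialg_unit_unique (f : bialg_hom bialg_base X) : f = bialg_unit.
Proof.
apply: bialg_hom_eq => a /=.
have -> : a = (a : K) *: (1 : bialg_base) by rewrite [RHS]mulr1.
rewrite (scalable_linear (@bialg_hom_linear _ _ _ f)) (bialg_hom_monoid f).1.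
by rewrite /unit_map [X in X *: 1]mulr1.
Qed.

End ZeroMaps.

Definition BiAlg : pointed_category := @PointedCategory BiAlgCat bialg_base
  bialg_counit bialg_counit_unique bialg_unit bialg_unit_unique.

End BiAlg.

(* Main.v *)
Require Import Defs.
From HB Require Import structures.
From mathcomp Require Import all_boot all_algebra.
From mathcomp Require Import sesquilinear boolp classical_sets.

(** Let [P] be the product of [Y] with itself, with projections [p1] and [p2].
The assignments [z |-> p1 z(1) (x) p2 z(2)] and [z |-> p1 z(2) (x) p2 z(1)]
([tpair] and [tpair_op]) are two algebra morphisms from [P] to the tensor
square of [Y], because the comultiplication and the flip are algebra morphisms.
They agree on the two canonical copies of [Y] in [P]: there one of [p1], [p2]
becomes the zero morphism, and both assignments give [y (x) 1], respectively
[1 (x) y]. If [Y] is unital these two copies generate [P] as an algebra, so the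
two morphisms are equal; evaluated on the diagonal of [Y] they yield the
comultiplication and its opposite, which must then be the same.

That the copies generate [P] is [jointly_extremally_epic_generates]. The
subalgebra they generate has to be made into a bialgebra whose inclusion is a
monomorphism, which requires its tensor square to embed into that of [P]. Over a
field, the subalgebra has a linear retraction ([subspace_projector]), and this
retraction provides left inverses of the maps between tensor powers. *)

Set Implicit Arguments.
Unset Strict Implicit.
Unset Printing Implicit Defensive.

Import GRing.Theory.
Local Open Scope ring_scope.
Local Open Scope tensor_scope.

(** * Complements of subspaces *)

(** The kernel of the projector is a complement of [M], found as a subset that
is maximal among those closed under combinations and meeting [M] only in 0. *)
Lemma subspace_projector (K : fieldType) (V : lmodType K) (M : V -> Prop) :
    M 0 -> (forall a x y, M x -> M y -> M (a *: x + y)) ->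
  exists p : V -> V, [/\ linear p, forall x, M (p x) & forall x, M x -> p x = x].
Proof.
move=> M0 MP.
have MB x y : M x -> M y -> M (x - y).
  by move=> Mx My; rewrite addrC -scaleN1r; apply: MP.
(* An independent set may be empty, so that the union of the empty chain is
   independent; [C0] below restores the zero vector. *)
pose indep (A : set V) := (forall a x y, A x -> A y -> A (a *: x + y)) /\
                          (forall x, A x -> M x -> x = 0).
have [|C [[CP CM] Cmax]] := @Zorn_bigcup V indep.
  move=> F Findep Ftot; split=> [a x y [A FA Ax] [B FB By]|x [A FA Ax]].
    have [AB|BA] := Ftot _ _ FA FB.
      by exists B => //; apply: (Findep _ FB).1 => //; apply: AB.
    by exists A => //; apply: (Findep _ FA).1 => //; apply: BA.
  exact: (Findep _ FA).2.
pose C0 x := C x \/ x = 0.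
have C0P a x y : C0 x -> C0 y -> C0 (a *: x + y).
  move=> [Cx|->] [Cy|->]; rewrite ?scaler0 ?add0r ?addr0; last by right.
  - by left; apply: CP.
  - by left; rewrite -[a](subrK 1) scalerDl scale1r; apply: CP.
  - by left.
have C0M x : C0 x -> M x -> x = 0 by move=> [|->//]; apply: CM.
(* Otherwise the combinations of [x] and [C0] are independent as well, hence
   contained in [C] by maximality, and [x] is the sum of 0 and a vector of [C]. *)
have split_sum x : exists m, M m /\ C0 (x - m).
  have [//|notsum] := pselect (exists m, M m /\ C0 (x - m)).
  pose D : set V := fun z => exists a c, C0 c /\ z = a *: x + c.
  have CD : subset C D.
    by move=> c Cc; exists 0, c; split; [left | rewrite scale0r add0r].
  have Dindep : indep D.
    split=> [a _ _ [b [c [Cc ->]]] [b' [c' [Cc' ->]]]|z [a [c [Cc ->]]] Mz].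
      exists (a * b + b'), (a *: c + c'); split; first exact: C0P.
      by rewrite scalerDr scalerDl scalerA addrACA.
    have [a0|an0] := eqVneq a 0.
      by move: Mz; rewrite a0 scale0r add0r; apply: C0M.
    case: notsum; exists (a^-1 *: (a *: x + c)); split.
      by rewrite -[_ *: _]addr0; apply: MP.
    rewrite scalerDr scalerA mulVf // scale1r opprD addNKr -scaleNr.
    by rewrite -[_ *: _]addr0; apply: C0P => //; right.
  have Cx : C x.
    have [//|nCx] := pselect (C x).
    case: (Cmax D) => //; split=> // DC; apply: nCx; apply: DC.
    by exists 1, 0; split; [right | rewrite scale1r addr0].
  by exists 0; rewrite subr0; split=> //; left.
have [p pP] := choice split_sum.
have pE x m : M m -> C0 (x - m) -> p x = m.
  move=> Mm Cm; apply/subr0_eq/C0M; last by apply: MB => //; case: (pP x).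
  have -> : p x - m = - 1 *: (x - p x) + (x - m).
    by rewrite scaleN1r opprB subrKA.
  by apply: C0P => //; case: (pP x).
exists p; split=> [a x y|x|x Mx].
- have [Mx Cx] := pP x; have [My Cy] := pP y; apply: pE; first exact: MP.
  by rewrite opprD addrACA -scalerBr; apply: C0P.
- by case: (pP x).
- by apply: pE => //; rewrite subrr; right.
Qed.

(** * Maps between tensor products *)

Section TensorMapTheory.
Variable K : fieldType.

Lemma linear_comp (U V W : lmodType K) (g : V -> W) (f : U -> V) :
  linear g -> linear f -> linear (g \o f).
Proof. by move=> lg lf a x y; rewrite /= lf lg. Qed.

Lemma tmap_comp (U V W U' V' W' : lmodType K) (g : V -> W) (f : U -> V)
    (g' : V' -> W') (f' : U' -> V') :
    linear g -> linear f -> linear g' -> linear f' ->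
  tmap g g' \o tmap f f' =1 tmap (g \o f) (g' \o f').
Proof.
move=> lg lf lg' lf'; apply: tensor_ext.
- by apply: linear_comp; apply: tmap_linear.
- by apply: tmap_linear; apply: linear_comp.
- by move=> u v; rewrite /= !tmapE //; apply: linear_comp.
Qed.

Lemma eq_tmap (V V' W W' : lmodType K) (f g : V -> V') (f' g' : W -> W') :
  f =1 g -> f' =1 g' -> tmap f f' =1 tmap g g'.
Proof. by move=> /funext -> /funext ->. Qed.

Lemma tmap_id (V W : lmodType K) : @tmap K V V W W idfun idfun =1 idfun.
Proof.
by apply: tensor_ext => [|//|v w]; [exact: tmap_linear | rewrite tmapE].
Qed.

Lemma tmap_cancel (V V' W W' : lmodType K) (f : V -> V') (g : V' -> V)
    (f' : W -> W') (g' : W' -> W) :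
    linear f -> linear g -> linear f' -> linear g' ->
  cancel f g -> cancel f' g' -> cancel (tmap f f') (tmap g g').
Proof.
move=> lf lg lf' lg' fK fK' x; have /= -> := tmap_comp lg lf lg' lf' x.
by rewrite (eq_tmap (g := idfun) (g' := idfun)) // tmap_id.
Qed.

Lemma tswap_linear (V W : lmodType K) : linear (@tswap K V W).
Proof.
apply: tlift_linear; split=> [y a x x'|x a y y'] /=.
- by rewrite tmulDr tmulZr.
- by rewrite tmulDl tmulZl.
Qed.

Lemma tassoc_natural (U V W U' V' W' : lmodType K) (f : U -> U') (g : V -> V')
    (h : W -> W') : linear f -> linear g -> linear h ->
  tmap f (tmap g h) \o @tassoc K U V W =1 @tassoc K U' V' W' \o tmap (tmap f g) h.
Proof.
move=> lf lg lh; have lfg := tmap_linear lf lg; have lgh := tmap_linear lg lh.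
have lf_gh := tmap_linear lf lgh; have lfg_h := tmap_linear lfg lh.
have la := @tassoc_linear K U V W; have la' := @tassoc_linear K U' V' W'.
apply: tensor_ext; try exact: linear_comp.
move=> t w; move: t; apply: tensor_ext.
- by move=> a x y; rewrite /= tmulDl tmulZl la lf_gh.
- by move=> a x y; rewrite /= tmulDl tmulZl lfg_h la'.
- by move=> u v; rewrite /= !(tassocE, tmapE).
Qed.

Lemma scale_formL_bilinear (X : lmodType K) (e : X -> K) : scalar e ->
  is_bilinear (fun a b : X => e a *: b).
Proof.
move=> le; split=> [b c a a'|a c b b'] /=; first by rewrite le scalerDl scalerA.
by rewrite scalerDr !scalerA mulrC.
Qed.

Lemma scale_formR_bilinear (X : lmodType K) (e : X -> K) : scalar e ->
  is_bilinear (fun a b : X => e b *: a).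
Proof.
move=> le; split=> [b c a a'|a c b b'] /=; last by rewrite le scalerDl scalerA.
by rewrite scalerDr !scalerA mulrC.
Qed.

Lemma comul_linear (X : bialgebra K) : linear (@comul K X).
Proof. exact: linearP. Qed.

Lemma tensorM (A B : algType K) (a a' : A) (b b' : B) :
  (a *t b) * (a' *t b') = (a * a') *t (b * b').
Proof. exact: tprodE. Qed.

Lemma tensor_monoid_morphism (A B : algType K) (R : pzRingType)
    (h : A \ox B -> R) : zmod_morphism h ->
    h 1 = 1 ->
    (forall a b a' b', h ((a *t b) * (a' *t b')) = h (a *t b) * h (a' *t b')) ->
  monoid_morphism h.
Proof.
move=> hB h1 hM; split=> // x y.
have h0 : h 0 = 0 by rewrite -(subrr 0) hB subrr.
have hN u : h (- u) = - h u by rewrite -[- u]sub0r hB h0 sub0r.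
have hD u v : h (u + v) = h u + h v by rewrite -{1}[v]opprK hB hN opprK.
elim/tensor_ind: x => [|a b x ihx]; first by rewrite mul0r h0 mul0r.
rewrite mulrDl !hD ihx mulrDl; congr (_ + _); clear ihx x.
elim/tensor_ind: y => [|a' b' y ihy]; first by rewrite mulr0 h0 mulr0.
by rewrite mulrDr !hD ihy mulrDr hM.
Qed.

Lemma tmap_monoid (A A' B B' : algType K) (f : A -> A') (g : B -> B') :
    linear f -> linear g -> monoid_morphism f -> monoid_morphism g ->
  monoid_morphism (tmap f g : A \ox B -> A' \ox B').
Proof.
move=> lf lg [f1 fM] [g1 gM]; apply: tensor_monoid_morphism.
- exact: zmod_morphism_linear (tmap_linear lf lg).
- by rewrite tmapE // f1 g1.
- by move=> a b a' b'; rewrite tensorM !tmapE // fM gM tensorM.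
Qed.

Lemma tswap_monoid (A B : algType K) :
  monoid_morphism (@tswap K A B : A \ox B -> B \ox A).
Proof.
apply: tensor_monoid_morphism.
- exact: zmod_morphism_linear (@tswap_linear _ _).
- by rewrite tswapE.
- by move=> a b a' b'; rewrite tensorM !tswapE tensorM.
Qed.

End TensorMapTheory.

(** * Subalgebras that are sub-bialgebras

An algebra embedding [i] with a linear retraction [r] is given, together with
a factorization of the comultiplication on its range through [tmap i i]. The
retraction makes [tmap i i], and all further tensor powers of [i], injective;
the bialgebra axioms for [B] then follow from those of [P]. *)

Section SubBialgebra.
Variables (K : fieldType) (B : algType K) (P : bialgebra K).
Variables (i : B -> P) (r : P -> B).
Hypotheses (i_linear : linear i) (i_monoid : monoid_morphism i).
Hypotheses (r_linear : linear r) (iK : cancel i r).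
Hypothesis comul_range : forall b, exists u, comul (i b) = tmap i i u.

Definition sub_comul (b : B) : B \ox B := tmap r r (comul (i b)).
Definition sub_counit (b : B) : K := counit (i b).

Lemma tmap_inclK : cancel (tmap i i) (tmap r r).
Proof. exact: tmap_cancel. Qed.

(** The retraction enters the definition of [sub_comul] only as a way of
inverting [tmap i i] on its range, so this equation determines [sub_comul]. *)
Lemma tmap_sub_comul b : tmap i i (sub_comul b) = comul (i b).
Proof. by rewrite /sub_comul; case: (comul_range b) => u ->; rewrite tmap_inclK. Qed.

Lemma sub_comul_linear : linear sub_comul.
Proof.
by move=> a x y; rewrite /sub_comul i_linear linearP (tmap_linear r_linear r_linear).
Qed.

Lemma sub_counit_linear : scalar sub_counit.
Proof. by move=> a x y; rewrite /sub_counit i_linear linearP. Qed.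

Definition sub_comul_lin : {linear B -> B \ox B} :=
  HB.pack sub_comul (GRing.isLinear.Build _ _ _ _ sub_comul sub_comul_linear).
Definition sub_counit_lin : {scalar B} :=
  HB.pack sub_counit (GRing.isLinear.Build _ _ _ _ sub_counit sub_counit_linear).

Lemma sub_comulA x :
  tassoc (tmap sub_comul_lin idfun (sub_comul_lin x)) =
  tmap idfun sub_comul_lin (sub_comul_lin x).
Proof.
change (tassoc (tmap sub_comul idfun (sub_comul x)) =
  tmap idfun sub_comul (sub_comul x)).
have lid (V : lmodType K) : linear (@idfun V) by [].
have lc := sub_comul_linear; have lD := @comul_linear K P.
have lii := tmap_linear i_linear i_linear.
have lrr := tmap_linear r_linear r_linear.
(* Compare both sides inside the triple tensor power of [P], where they are the
   two iterated comultiplications of [i x]. *)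
apply: (can_inj (tmap_cancel i_linear r_linear lii lrr iK tmap_inclK)).
have /= -> := tassoc_natural i_linear i_linear i_linear _.
have /= -> := tmap_comp lii lc i_linear (lid B) (sub_comul x).
have /= -> := tmap_comp i_linear (lid B) lii lc (sub_comul x).
rewrite (eq_tmap (g := comul \o i) (g' := idfun \o i)) //; last exact: tmap_sub_comul.
rewrite [RHS](eq_tmap (g := idfun \o i) (g' := comul \o i)) //;
  last exact: tmap_sub_comul.
have /= <- := tmap_comp lD i_linear (lid P) i_linear (sub_comul x).
have /= <- := tmap_comp (lid P) i_linear lD i_linear (sub_comul x).
by rewrite tmap_sub_comul comulA.
Qed.

Lemma sub_counitl x : tlift (fun a b => sub_counit_lin a *: b) (sub_comul_lin x) = x.
Proof.
have bl := scale_formL_bilinear sub_counit_linear.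
have bl' : is_bilinear (fun a b : P => counit a *: b).
  by apply: scale_formL_bilinear; exact: linearP.
apply: (can_inj iK); rewrite -[RHS]counitl -tmap_sub_comul.
have lii := tmap_linear i_linear i_linear.
suff E : i \o tlift (fun a b => sub_counit_lin a *: b) =1
   tlift (fun a b : P => counit a *: b) \o tmap i i by exact: E.
apply: tensor_ext.
- exact: linear_comp i_linear (tlift_linear bl).
- exact: linear_comp (tlift_linear bl') lii.
- by move=> u v; rewrite /= tmapE // !tlift_tmul // (scalable_linear i_linear).
Qed.

Lemma sub_counitr x : tlift (fun a b => sub_counit_lin b *: a) (sub_comul_lin x) = x.
Proof.
have bl := scale_formR_bilinear sub_counit_linear.
have bl' : is_bilinear (fun a b : P => counit b *: a).
  by apply: scale_formR_bilinear; exact: linearP.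
apply: (can_inj iK); rewrite -[RHS]counitr -tmap_sub_comul.
have lii := tmap_linear i_linear i_linear.
suff E : i \o tlift (fun a b => sub_counit_lin b *: a) =1
   tlift (fun a b : P => counit b *: a) \o tmap i i by exact: E.
apply: tensor_ext.
- exact: linear_comp i_linear (tlift_linear bl).
- exact: linear_comp (tlift_linear bl') lii.
- by move=> u v; rewrite /= tmapE // !tlift_tmul // (scalable_linear i_linear).
Qed.

Lemma sub_comul_monoid : monoid_morphism sub_comul_lin.
Proof.
have [ii1 iiM] := tmap_monoid i_linear i_linear i_monoid i_monoid.
have [D1 DM] := comul_monoid P.
split=> [|x y]; apply: (can_inj tmap_inclK).
  by rewrite tmap_sub_comul i_monoid.1 D1 ii1.
by rewrite iiM !tmap_sub_comul i_monoid.2 DM.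
Qed.

Lemma sub_counit_monoid : monoid_morphism sub_counit_lin.
Proof.
have [e1 eM] := counit_monoid P.
by split=> [|x y]; rewrite /= /sub_counit ?i_monoid.1 ?i_monoid.2.
Qed.

Definition sub_bialgebra : bialgebra K := Bialgebra sub_comulA sub_counitl sub_counitr
  sub_comul_monoid sub_counit_monoid.

Lemma sub_incl_comul (x : sub_bialgebra) :
  comul (i x) = tmap (i : sub_bialgebra -> P) (i : sub_bialgebra -> P) (comul x).
Proof. by rewrite tmap_sub_comul. Qed.

Definition sub_incl : bialg_hom sub_bialgebra P :=
  @BialgHom K sub_bialgebra P i i_linear i_monoid sub_incl_comul (fun=> erefl).

Lemma sub_incl_mono : @monomorphism (BiAlgCat K) sub_bialgebra P sub_incl.
Proof.
move=> Z f g fg; apply: bialg_hom_eq => z; apply: (can_inj iK).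
exact: (congr1 (fun h : bialg_hom Z P => h z) fg).
Qed.

(** The corestriction of [f] is compatible with the comultiplications because
this can be tested after applying the injective map [tmap i i]. *)
Lemma factors_through_sub (Z : bialgebra K) (f : bialg_hom Z P) :
    (forall z, i (r (f z)) = f z) ->
  @factors_through (BiAlgCat K) Z sub_bialgebra P f sub_incl.
Proof.
move=> fr; pose g z : sub_bialgebra := r (f z).
have gE z : i (g z) = f z := fr z.
have i_inj := can_inj iK.
have lf := @bialg_hom_linear _ _ _ f; have [f1 fM] := bialg_hom_monoid f.
have lg : linear g by move=> a x y; rewrite /g lf r_linear.
have mg : monoid_morphism g.
  by split=> [|x y]; apply: i_inj; rewrite ?i_monoid.1 ?i_monoid.2 !gE.
have cg z : comul (g z) = tmap g g (comul z).
  apply: (can_inj tmap_inclK); rewrite tmap_sub_comul gE bialg_hom_comul.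
  have /= -> := tmap_comp i_linear lg i_linear lg (comul z).
  by apply: eq_tmap => y; rewrite -gE.
have eg z : counit (g z) = counit z.
  by rewrite -(bialg_hom_counit f) -gE.
by exists (BialgHom lg mg cg eg); apply: bialg_hom_eq.
Qed.

End SubBialgebra.

(** * Generated subalgebras *)

Section GeneratedSubalgebra.
Variables (K : fieldType) (A : algType K) (G : A -> Prop).

Definition subalgebra (S : A -> Prop) : Prop :=
  [/\ S 1, forall a x y, S x -> S y -> S (a *: x + y)
    & forall x y, S x -> S y -> S (x * y)].

Definition generated : {pred A} :=
  fun x => `[< forall S, subalgebra S -> (forall y, G y -> S y) -> S x >].

Lemma generatedP x :
  reflect (forall S, subalgebra S -> (forall y, G y -> S y) -> S x)
          (x \in generated).
Proof. exact: asboolP. Qed.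

Lemma generated_gen x : G x -> x \in generated.
Proof. by move=> Gx; apply/generatedP => S _; apply. Qed.

Lemma generated_closed : subalg_closed generated.
Proof.
split=> [|a x y /generatedP Sx /generatedP Sy|x y /generatedP Sx /generatedP Sy];
  apply/generatedP => S HS SG; have [S1 SP SM] := HS => //.
  by apply: SP; [apply: Sx | apply: Sy].
by apply: SM; [apply: Sx | apply: Sy].
Qed.

HB.instance Definition _ :=
  GRing.isSubalgClosed.Build K A generated generated_closed.

Record generated_alg := GeneratedAlg
  { generated_val : A; generated_valP : generated_val \in generated }.

HB.instance Definition _ := [isSub for generated_val].
HB.instance Definition _ := [Choice of generated_alg by <:].
HB.instance Definition _ := [SubChoice_isSubAlgebra of generated_alg by <:].

End GeneratedSubalgebra.

(** The preimage, under an algebra morphism, of the range of another one. It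
serves to check on generators that the comultiplication restricts. *)
Lemma subalgebra_preim (K : fieldType) (A B B' R R' : algType K)
    (h : A -> B \ox B') (i : R \ox R' -> B \ox B') :
  linear h -> linear i -> monoid_morphism h -> monoid_morphism i ->
  subalgebra (fun x => exists u, h x = i u).
Proof.
move=> lh li [h1 hM] [i1 iM]; split=> [|a x y [u hu] [v hv]|x y [u hu] [v hv]].
- by exists 1; rewrite h1 i1.
- by exists (a *: u + v); rewrite lh li hu hv.
- by exists (u * v); rewrite hM iM hu hv.
Qed.

Lemma subalgebra_equalizer (K : fieldType) (A B B' : algType K)
    (g h : A -> B \ox B') :
  linear g -> linear h -> monoid_morphism g -> monoid_morphism h ->
  subalgebra (fun x => g x = h x).
Proof.
move=> lg lh [g1 gM] [h1 hM]; split=> [|a x y gx gy|x y gx gy].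
- by rewrite g1 h1.
- by rewrite lg lh gx gy.
- by rewrite gM hM gx gy.
Qed.

(** * Joint extremal epimorphy as generation *)

(** The subalgebra generated by the ranges of [k] and [s] is a sub-bialgebra:
the elements whose comultiplication stays in its tensor square form a
subalgebra, which contains the two ranges as [k] and [s] are coalgebra
morphisms. Both [k] and [s] factor through its inclusion, a monomorphism,
which is therefore onto. *)
Lemma jointly_extremally_epic_generates (K : fieldType) (X Y P : bialgebra K)
    (k : bialg_hom X P) (s : bialg_hom Y P) (S : P -> Prop) :
    @jointly_extremally_epic (BiAlgCat K) X P Y k s ->
    subalgebra S -> (forall x, S (k x)) -> (forall y, S (s y)) ->
  forall z, S z.
Proof.
move=> jee subS Sk Ss.
pose G z := (exists x, z = k x) \/ (exists y, z = s y).
pose B : algType K := generated_alg G.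
pose i : B -> P := val.
have i_linear : linear i by move=> a x y; rewrite /i linearP.
have i_monoid : monoid_morphism i by split=> [|x y]; rewrite /i ?rmorph1 ?rmorphM.
have [g1 gP gM] := generated_closed G.
have [|a x y|p [p_linear pG pE]] :=
    @subspace_projector K P (fun z => z \in generated G).
- by rewrite -[0](subrr 1) addrC -scaleN1r; apply: gP.
- exact: gP.
pose r (z : P) : B := GeneratedAlg (pG z).
have r_linear : linear r.
  move=> a x y; apply: val_inj; rewrite [RHS]i_linear; exact: p_linear.
have iK : cancel i r by move=> b; apply: val_inj; apply: pE; case: b.
have rK z : z \in generated G -> i (r z) = z by exact: pE.
have Gk x : i (r (k x)) = k x by apply/rK/generated_gen; left; exists x.
have Gs y : i (r (s y)) = s y by apply/rK/generated_gen; right; exists y.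
have comul_gen (Z : bialgebra K) (f : bialg_hom Z P) :
    (forall z, i (r (f z)) = f z) ->
    forall z, exists u, comul (f z) = tmap i i u.
  move=> fr z; exists (tmap (r \o f) (r \o f) (comul z)).
  have rf_linear := linear_comp r_linear (@bialg_hom_linear _ _ _ f).
  have /= -> := tmap_comp i_linear rf_linear i_linear rf_linear (comul z).
  by rewrite bialg_hom_comul; apply: eq_tmap => x; rewrite /= fr.
have comul_range b : exists u, comul (i b) = tmap i i u.
  have lD := @comul_linear K P.
  have lii := tmap_linear i_linear i_linear.
  have mii := tmap_monoid i_linear i_linear i_monoid i_monoid.
  apply: (generatedP G (i b) (valP b) (fun z => exists u, comul z = tmap i i u)).
    exact: subalgebra_preim lD lii (comul_monoid P) mii.
  by move=> _ [[x ->]|[y ->]]; apply: comul_gen.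
have [||h [_ /(congr1 (fun f : bialg_hom P P => f _)) ih]] := jee _
    (sub_incl i_linear i_monoid r_linear iK comul_range)
    (@sub_incl_mono _ _ _ _ _ _ _ _ _ _).
- exact: factors_through_sub.
- exact: factors_through_sub.
move=> z; have <- : i ((h : bialg_hom _ _) z) = z by exact: ih.
apply: (generatedP G _ (valP _) S) => // _ [[x ->]|[y ->]] //.
Qed.

(** * Comparing the two orders of the comultiplication *)

Section ConvolutionWithUnit.
Variables (K : fieldType) (X : bialgebra K).

(** [y |-> counit y *: 1] is the counit of [X] followed by the unit of [B], that
is, the zero morphism when [B] is a bialgebra. *)
Lemma tmap_counitr (V : lmodType K) (B : algType K) (f : X -> V) (x : X) :
  linear f -> tmap f (fun y => counit y *: (1 : B)) (comul x) = f x *t (1 : B).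
Proof.
move=> lf; rewrite -[x in RHS]counitr.
have bl : is_bilinear (fun a b : X => counit b *: a).
  by apply: scale_formR_bilinear; exact: linearP.
have le : linear (fun y : X => counit y *: (1 : B)).
  by move=> a u v; rewrite linearP scalerDl scalerA.
suff E : tmap f (fun y => counit y *: (1 : B)) =1
    (fun y => f y *t (1 : B)) \o tlift (fun a b : X => counit b *: a) by exact: E.
apply: tensor_ext; first exact: tmap_linear.
- move=> a u v; by rewrite /= (tlift_linear bl) lf tmulDl tmulZl.
- move=> u v; rewrite tmapE //= tlift_tmul // (scalable_linear lf).
  by rewrite tmulZl tmulZr.
Qed.

Lemma tmap_counitl (V : lmodType K) (B : algType K) (f : X -> V) (x : X) :
  linear f -> tmap (fun y => counit y *: (1 : B)) f (comul x) = (1 : B) *t f x.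
Proof.
move=> lf; rewrite -[x in RHS]counitl.
have bl : is_bilinear (fun a b : X => counit a *: b).
  by apply: scale_formL_bilinear; exact: linearP.
have le : linear (fun y : X => counit y *: (1 : B)).
  by move=> a u v; rewrite linearP scalerDl scalerA.
suff E : tmap (fun y => counit y *: (1 : B)) f =1
    (fun y => (1 : B) *t f y) \o tlift (fun a b : X => counit a *: b) by exact: E.
apply: tensor_ext; first exact: tmap_linear.
- move=> a u v; by rewrite /= (tlift_linear bl) lf tmulDr tmulZr.
- move=> u v; rewrite tmapE //= tlift_tmul // (scalable_linear lf).
  by rewrite tmulZl tmulZr.
Qed.

End ConvolutionWithUnit.

(** A span of bialgebra morphisms induces two algebra morphisms to the tensor
product. They need not be coalgebra morphisms, and they coincide when [P] is
cocommutative. *)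
Section PairMaps.
Variables (K : fieldType) (P X Y : bialgebra K).
Variables (f : bialg_hom P X) (g : bialg_hom P Y).

Definition tpair (z : P) : X \ox Y := tmap f g (comul z).
Definition tpair_op (z : P) : X \ox Y := tswap (tmap g f (comul z)).

Lemma tpair_subalgebra : subalgebra (fun z => tpair z = tpair_op z).
Proof.
have lf := @bialg_hom_linear _ _ _ f; have mf := bialg_hom_monoid f.
have lg := @bialg_hom_linear _ _ _ g; have mg := bialg_hom_monoid g.
have lD := @comul_linear K P; have [D1 DM] := comul_monoid P.
have [fg1 fgM] := tmap_monoid lf lg mf mg.
have [gf1 gfM] := tmap_monoid lg lf mg mf.
have [sw1 swM] := @tswap_monoid K Y X.
apply: subalgebra_equalizer.
- exact: linear_comp (tmap_linear lf lg) lD.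
- exact: linear_comp (@tswap_linear _ _ _) (linear_comp (tmap_linear lg lf) lD).
- by split=> [|x y]; rewrite /tpair ?D1 ?DM.
- by split=> [|x y]; rewrite /tpair_op ?D1 ?DM ?gf1 ?gfM.
Qed.

Lemma tpair_comp (Z : bialgebra K) (h : bialg_hom Z P) (z : Z) :
  tpair (h z) = tmap (f \o h) (g \o h) (comul z).
Proof.
have lf := @bialg_hom_linear _ _ _ f; have lg := @bialg_hom_linear _ _ _ g.
have lh := @bialg_hom_linear _ _ _ h.
by rewrite /tpair bialg_hom_comul; have /= -> := tmap_comp lf lh lg lh (comul z).
Qed.

Lemma tpair_op_comp (Z : bialgebra K) (h : bialg_hom Z P) (z : Z) :
  tpair_op (h z) = tswap (tmap (g \o h) (f \o h) (comul z)).
Proof.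
have lf := @bialg_hom_linear _ _ _ f; have lg := @bialg_hom_linear _ _ _ g.
have lh := @bialg_hom_linear _ _ _ h.
by rewrite /tpair_op bialg_hom_comul; have /= -> := tmap_comp lg lh lf lh (comul z).
Qed.

End PairMaps.

(** For [X := Y], the diagonal [diag] composed with [tpair] is the
comultiplication of [Y], and composed with [tpair_op] the opposite one. *)
Theorem mainTheorem4 (K : fieldType) (Y : bialgebra K) :
  unital_object (Y : BiAlg K) -> cocommutative Y.
Proof.
move=> /(_ Y) [P jee] y.
pose p1 : bialg_hom (prod_ob P : bialgebra K) Y := proj1 P.
pose p2 : bialg_hom (prod_ob P : bialgebra K) Y := proj2 P.
have comp_fun (A B C : bialgebra K) (g : bialg_hom B C) (f : bialg_hom A B)
    (h : bialg_hom A C) : bialg_comp g f = h -> g \o f =1 h by move=> <-.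
pose id1 : @Defs.hom (BiAlg K) Y Y := idm (Y : BiAlg K).
pose zero : @Defs.hom (BiAlg K) Y Y := zerom (Y : BiAlg K) (Y : BiAlg K).
have lid : linear (@idfun Y) by [].
have k1 := comp_fun _ _ _ _ _ _ (proj1_pairing P id1 zero).
have k2 := comp_fun _ _ _ _ _ _ (proj2_pairing P id1 zero).
have s1 := comp_fun _ _ _ _ _ _ (proj1_pairing P zero id1).
have s2 := comp_fun _ _ _ _ _ _ (proj2_pairing P zero id1).
have d1 := comp_fun _ _ _ _ _ _ (proj1_pairing P id1 id1).
have d2 := comp_fun _ _ _ _ _ _ (proj2_pairing P id1 id1).
have agree := jointly_extremally_epic_generates jee (tpair_subalgebra p1 p2).
pose diag : bialg_hom Y (prod_ob P : bialgebra K) := pairing P id1 id1.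
have : tpair p1 p2 (diag y) = tpair_op p1 p2 (diag y).
  apply: agree => x; rewrite tpair_comp tpair_op_comp.
    rewrite (eq_tmap k1 k2) (eq_tmap k2 k1).
    by rewrite (tmap_counitr Y x lid) (tmap_counitl Y x lid) tswapE.
  rewrite (eq_tmap s1 s2) (eq_tmap s2 s1).
  by rewrite (tmap_counitr Y x lid) (tmap_counitl Y x lid) tswapE.
by rewrite tpair_comp tpair_op_comp (eq_tmap d1 d2) (eq_tmap d2 d1) !tmap_id.
Qed.
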